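(* Let $n \geq 1$ and let $q \in \mathbb{C}$ be a primitive $n$th root of unity. Then $$\sum_{k=0}^{n-1} (q)_k = \frac{-1}{n} \sum_{k=-n}^{n-1} \sum_{j=-k}^k \left(k^2-\frac{j(3j+1)}{2}\right) q^{-k^2 + j(3j+1)/2}(-1)^j$$ and $$\sum_{k=0}^{n-1} (q)_k^2\,q^{k+1} = \frac{-1}{n} \sum_{k=-n}^{n-1} \sum_{j=-k}^k \left(k^2-\frac{j(3j+1)}{2}\right)q^{k^2-j(3j+1)/2}(-1)^j.$$
   Context: For a non-negative integer $k$, $(q)_k = (q;q)_k = \prod_{i=1}^{k}(1-q^i)$. Sums with reversed limits follow the convention that for any $f$, $\sum_{j=a}^b f(j) = - \sum_{j=b+1}^{a-1} f(j)$ whenever $a > b$; in particular, for $k<0$, $\sum_{j=-k}^{k} f(j) = -\sum_{j=k+1}^{-k-1} f(j)$. *)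

(* Defs.v *)
From mathcomp Require Import all_boot all_order all_algebra.

Set Implicit Arguments.
Unset Strict Implicit.
Unset Printing Implicit Defensive.

Import Order.TTheory GRing.Theory Num.Theory.
Local Open Scope ring_scope.

Definition qpoch (R : pzRingType) (q : R) (k : nat) : R :=
  \prod_(1 <= i < k.+1) (1 - q ^+ i).

Definition int_range (a b : int) : seq int :=
  if a <= b then [seq a + i%:Z | i <- iota 0 `|b - a|%N.+1] else [::].

(* Sum over j = a, ..., b of f j, with the reversed-limits convention
   sum_{j=a}^b f j = - sum_{j=b+1}^{a-1} f j  when a > b
   (which gives 0 when a = b + 1). *)
Definition int_sum (V : zmodType) (a b : int) (f : int -> V) : V :=
  if a <= b then \sum_(j <- int_range a b) f j
  else - \sum_(j <- int_range (b + 1) (a - 1)) f j.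

(* The division is exact: j * (3 * j + 1) is always even. *)
Definition pentagonal (j : int) : int := ((j * (3 * j + 1)) %/ 2)%Z.

(* Main.v *)
Require Import Defs.
From HB Require Import structures.
From mathcomp Require Import all_boot all_order all_algebra.
From mathcomp Require Import reals complex.
From mathcomp Require Import zify ring.
Import GRing.Theory Num.Theory.
Local Open Scope ring_scope.
Local Open Scope complex_scope.

(** Up to the factor -1/n, the right-hand sides are values, at a root of unity, of
    the derivative of one Laurent polynomial. Put

      P_n(q) = \sum_(k = -n)^(n-1) \sum_(j = -k)^k (-1)^j q^(k^2 - j(3j+1)/2),

    which is hecke_sum. The Euler operator q d/dq multiplies
    every monomial by its exponent, so the double sums of the first and of the
    second identity are the values of q P_n'(q) at q^-1 and at q. It remains to
    factor P_n, for every unit q, as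

      P_n(q) = (1 - q^n) (-1)^(n+1) q^(-C(n,2)) \sum_(k<n) q^(nk) (q^n/q;1/q)_k
             = (1 - q^n) (-1)^(n+1) q^(1-C(n+1,2))
                 \sum_(k<n) q^k (q/q^n)_k (q q^n)_k

    (hecke_sum_kz, hecke_sum_unimodal): at a primitive n-th root of unity z the
    factor 1 - q^n vanishes and has derivative -n under q d/dq, the monomial
    prefactors become 1 and z because z^C(n,2) = (-1)^(n+1) (prim_root_bin2), and
    the remaining sums become \sum (1/z;1/z)_k and \sum (z)_k^2 z^k.

    The factorizations hold because three sequences obey one first-order
    recurrence. Pairing the outer indices k = -m-1 and k = m gives
    P_(m+1) - P_m = (q^(m^2) - q^((m+1)^2)) S_m with
    S_m = \sum_(|j| <= m) (-1)^j q^(-j(3j+1)/2); by induction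
    P_m = (-1)^m q^(-C(m+1,2)) - q^(m^2) S_m (hecke_sum_closed), and eliminating
    S_m leaves a recurrence for P_m alone (hecke_sum_rec). The two single sums,
    which are expressions for the coloured Jones polynomial of the trefoil,
    satisfy the same recurrence up to a monomial factor, by telescoping
    (kz_telescope, unimodal_telescope).

    The derivative is taken algebraically: all of the above is valid in any
    commutative ring with q a unit, and the dual number z + z eps has e-th power
    z^e + e z^e eps for every integer e, so that q d/dq at z is the eps-part of
    the value at this point. *)

(** * Sums over integer intervals *)

Section IntSum.
Variable V : zmodType.
Implicit Types (f g : int -> V) (a : int) (n : nat).

Lemma int_sumE a n f :
  int_sum a (a + n%:Z - 1) f = \sum_(0 <= i < n) f (a + i%:Z).
Proof.
rewrite /int_sum /int_range; case: n => [|n].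
  rewrite ifF; last by lia.
  by rewrite ifF ?big_nil ?oppr0 ?big_geq //; lia.
rewrite !ifT; try lia.
by rewrite big_map (_ : absz _ = n) ?big_mkord //; lia.
Qed.

(** The ranges of the double sum and of its inner sum gain a term at each end when
    n grows by one. *)
Lemma int_sum_both_ends a n f :
  int_sum (a - 1) (a + n%:Z) f =
    f (a - 1) + int_sum a (a + n%:Z - 1) f + f (a + n%:Z).
Proof.
rewrite (_ : a + n%:Z = (a - 1) + n.+2%:Z - 1); last by lia.
rewrite int_sumE big_nat_recl // big_nat_recr //= addr0 addrA.
rewrite (_ : a - 1 + n.+2%:Z - 1 - 1 = a + n%:Z - 1); last by lia.
rewrite int_sumE; congr (_ + _ + f _); last by lia.
by apply: eq_bigr => i _; congr f; lia.
Qed.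

(** For negative k the inner sum is, by the convention on reversed limits, minus
    the one for -k-1. *)
Lemma int_sum_sym n f : int_sum (n.+1)%:Z (- (n.+1)%:Z) f = - int_sum (- n%:Z) n f.
Proof.
have -> : int_sum (- n%:Z) n f = \sum_(j <- int_range (- n%:Z) n) f j.
  by rewrite /int_sum ifT //; lia.
rewrite /int_sum (_ : (_ <= _) = false); last by lia.
by congr (- \sum_(j <- int_range _ _) f j); lia.
Qed.

Lemma eq_int_sum a b f g : f =1 g -> int_sum a b f = int_sum a b g.
Proof.
by move=> fg; rewrite /int_sum; case: ifP => _; [|congr (- _)]; apply: eq_bigr.
Qed.

Lemma int_sum_raddf (U : zmodType) (h : {additive U -> V}) a b (f : int -> U) :
  h (int_sum a b f) = int_sum a b (h \o f).
Proof. by rewrite /int_sum; case: ifP => _; rewrite ?raddfN raddf_sum. Qed.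

End IntSum.

Lemma int_sum_mulr (A : pzRingType) (c : A) a b (f : int -> A) :
  int_sum a b (fun j => c * f j) = c * int_sum a b f.
Proof. by rewrite /int_sum; case: ifP => _; rewrite ?mulrN mulr_sumr. Qed.

(** * Pentagonal exponents *)

Lemma double_bin2 m : ('C(m, 2) * 2 = m * m.-1)%N.
Proof. by rewrite mulnC mul_bin_left bin1 subn1 mulnC. Qed.

Lemma pentagonalE j (e : int) : e * 2 = j * (3 * j + 1) -> pentagonal j = e.
Proof. by rewrite /pentagonal => <-; rewrite mulzK. Qed.

Lemma pentagonal_nat (m : nat) : pentagonal m = (m ^ 2 + 'C(m.+1, 2))%N.
Proof. by apply: pentagonalE; have /= := double_bin2 m.+1; nia. Qed.

Lemma pentagonal_oppn (m : nat) : pentagonal (- m%:Z) = (m ^ 2 + 'C(m, 2))%N.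
Proof. by apply: pentagonalE; case: m => // m; have /= := double_bin2 m.+1; nia. Qed.

(** * The sums and products involved *)

Definition hecke_sum {A : unitRingType} (q : A) (n : nat) : A :=
  int_sum (- n%:Z) (n%:Z - 1) (fun k : int => int_sum (- k) k (fun j : int =>
    q ^ (k ^+ 2 - pentagonal j) * (-1) ^ j)).

Definition pent_sum {A : unitRingType} (q : A) (n : nat) : A :=
  int_sum (- n%:Z) n (fun j : int => q ^ (- pentagonal j) * (-1) ^ j).

(** The q-shifted factorial (a q; q)_k, with the first factor 1 - a left out so
    that a = 1 gives (q)_k. *)
Definition qprod {A : pzRingType} (a q : A) (k : nat) : A :=
  \prod_(1 <= i < k.+1) (1 - a * q ^+ i).

(** * Two telescoping sums *)

Section QProd.
Context {A : comPzRingType}.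
Implicit Types a q : A.

Lemma qprod0 a q : qprod a q 0 = 1.
Proof. by rewrite /qprod big_geq. Qed.
Lemma qprodS a q k : qprod a q k.+1 = qprod a q k * (1 - a * q ^+ k.+1).
Proof. by rewrite /qprod big_nat_recr. Qed.
Lemma qprodSl a q k : qprod a q k.+1 = (1 - a * q) * qprod (a * q) q k.
Proof.
rewrite /qprod big_nat_recl //= expr1; congr (_ * _).
by rewrite !big_add1 /=; apply: eq_bigr => i _; rewrite exprS mulrA.
Qed.

Lemma qprod1 q k : qprod 1 q k = qpoch q k.
Proof. by apply: eq_bigr => i _; rewrite mul1r. Qed.

(** As x y^(k+1) (x y; y)_k is the difference of the products of lengths k and
    k+1, the factor x^3 y^2 makes every term of the second sum a difference, and
    the differences cancel the first sum except at its ends. For x = q^(m+1) and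
    y = 1/q the last product vanishes, and the identity links the sums for x and
    x y, that is for m+1 and m. *)
Lemma kz_telescope (x y : A) m :
  (1 - x) * (\sum_(0 <= k < m.+1) x ^+ k * qprod x y k)
    + x ^+ 3 * y ^+ 2 * (\sum_(0 <= k < m) (x * y) ^+ k * qprod x y k.+1)
  = 1 - x ^+ 2 * y - x ^+ m.+1 * qprod x y m.+1.
Proof.
elim: m => [|m IH]; first by rewrite big_nat1 big_geq // qprodS qprod0; ring.
rewrite big_nat_recr //= [X in _ + _ * X]big_nat_recr //=.
rewrite [qprod x y m.+2]qprodS.
transitivity (1 - x ^+ 2 * y - x ^+ m.+1 * qprod x y m.+1 +
  ((1 - x) * (x ^+ m.+1 * qprod x y m.+1) +
   x ^+ 3 * y ^+ 2 * ((x * y) ^+ m * qprod x y m.+1))); first by rewrite -IH; ring.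
by rewrite exprMn !exprS; ring.
Qed.

(** When x q z = 1, the k-th terms on the left combine into a constant multiple of
    u_k - u_(k+1), where u_k = (z q)_k (x q)_k. With
    x = q^m the first sum belongs to m+1 and the second to m, each up to the
    factor split off by qprodSl. *)
Lemma unimodal_telescope (q x z : A) m : x * q * z = 1 ->
  (\sum_(0 <= k < m) q ^+ k * qprod z q k * qprod x q k.+1)
    - q ^+ 2 * x ^+ 4 * (\sum_(0 <= k < m) q ^+ k * qprod z q k.+1 * qprod x q k)
  = x * (1 - q * x ^+ 2) * (1 - qprod z q m * qprod x q m).
Proof.
move=> xqz; elim: m => [|m IH]; first by rewrite !big_geq // !qprod0; ring.
rewrite big_nat_recr //= [X in _ - _ * X]big_nat_recr //= !qprodS.
set u := qprod z q m in IH *; set v := qprod x q m in IH *.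
transitivity (x * (1 - q * x ^+ 2) * (1 - u * v) +
  q ^+ m * u * v * ((1 - x * q ^+ m.+1) -
     q * x ^+ 3 * (x * q - (x * q * z) * q ^+ m.+1))); first by rewrite -IH; ring.
(* The last factor is x (1 - u_(m+1) / u_m), rewritten with x q z = 1. *)
rewrite xqz mul1r.
transitivity (x * (1 - q * x ^+ 2) * (1 - u * v) + u * v *
   (1 - q * x ^+ 2) * (x * q ^+ m.+1 * x + (x * q * z) * q ^+ m
                       - x * (x * q * z) * q ^+ m * q ^+ m.+1)).
  by rewrite xqz [q ^+ m.+1]exprS; ring.
by rewrite [q ^+ m.+1]exprS; ring.
Qed.
End QProd.

(** * Factorization of the double sum *)

Section Hecke.
Context {A : comUnitRingType} {q : A} (uq : q \is a GRing.unit).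
Local Notation w := (q^-1).

Lemma exprN1_opp m : (-1 : A) ^ (- m%:Z) = (-1) ^+ m.
Proof. by rewrite -exprnN invr_sign. Qed.

Lemma pent_sum0 : pent_sum q 0 = 1.
Proof.
by rewrite /pent_sum /int_sum /= /int_range /= big_seq1 /= mulr1.
Qed.

(** The new terms j = m+1 and j = -m-1 of S_(m+1) have exponents
    -(m+1)^2 - C(m+2,2) and -(m+1)^2 - C(m+1,2). *)
Lemma pent_sumS m :
  q ^+ (m.+1 ^ 2) * pent_sum q m.+1 =
    q ^+ (m.+1 ^ 2) * pent_sum q m
    + (-1) ^+ m.+1 * (w ^+ 'C(m.+2, 2) + w ^+ 'C(m.+1, 2)).
Proof.
rewrite /pent_sum (_ : - m.+1%:Z = - m%:Z - 1); last by lia.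
rewrite [X in int_sum _ X](_ : m.+1%:Z = - m%:Z + (m.*2.+1)%:Z); last by lia.
rewrite int_sum_both_ends (_ : - m%:Z - 1 = - m.+1%:Z); last by lia.
rewrite (_ : - m%:Z + (m.*2.+1)%:Z - 1 = m); last by lia.
rewrite (_ : - m%:Z + (m.*2.+1)%:Z = m.+1); last by lia.
rewrite pentagonal_nat pentagonal_oppn exprN1_opp -[(-1) ^ m.+1%:Z]/((-1) ^+ m.+1).
move: 'C(_, 2) 'C(_, 2) => a b; rewrite -!exprnN -!exprVn !exprD.
set u := q ^+ (m.+1 ^ 2); set v := w ^+ (m.+1 ^ 2).
have uv : u * v = 1 by rewrite -exprMn divrr ?expr1n.
set s := (-1) ^+ _.
transitivity (u * int_sum (- m%:Z) m (fun j => q ^ (- pentagonal j) * (-1) ^ j)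
  + (u * v) * (s * (w ^+ a + w ^+ b))); first by ring.
by rewrite uv; ring.
Qed.

Lemma hecke_inner (k : int) (m : nat) : k = m%:Z \/ k = - m%:Z ->
  forall a b,
  int_sum a b (fun j => q ^ (k ^+ 2 - pentagonal j) * (-1) ^ j)
  = q ^+ (m ^ 2) * int_sum a b (fun j => q ^ (- pentagonal j) * (-1) ^ j).
Proof.
move=> km a b; rewrite -int_sum_mulr; apply: eq_int_sum => j.
rewrite mulrA -[q ^+ (m ^ 2)]/(q ^ (m ^ 2)%N%:Z) -exprzDr //.
by congr (q ^ (_ - _) * _); case: km => ->; lia.
Qed.

Lemma hecke_sum0 : hecke_sum q 0 = 0.
Proof. by rewrite /hecke_sum /int_sum /= /int_range /= big_nil oppr0. Qed.

Lemma hecke_sumS m : hecke_sum q m.+1 =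
  hecke_sum q m + (q ^+ (m ^ 2) - q ^+ (m.+1 ^ 2)) * pent_sum q m.
Proof.
rewrite /hecke_sum (_ : - m.+1%:Z = - m%:Z - 1); last by lia.
rewrite [X in int_sum _ X](_ : m.+1%:Z - 1 = - m%:Z + (m.*2)%:Z); last by lia.
rewrite int_sum_both_ends (_ : - m%:Z - 1 = - m.+1%:Z); last by lia.
rewrite (_ : - m%:Z + (m.*2)%:Z - 1 = m%:Z - 1); last by lia.
rewrite (_ : - m%:Z + (m.*2)%:Z = m); last by lia.
rewrite (@hecke_inner _ m.+1); last by right.
rewrite (@hecke_inner m m); last by left.
by rewrite opprK int_sum_sym /pent_sum; ring.
Qed.

(** The double sum collapses to a single one: the correction
    q^((m+1)^2) (S_(m+1) - S_m) of pent_sumS turns the monomial for m into the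
    monomial for m+1. *)
Lemma hecke_sum_closed m :
  hecke_sum q m = (-1) ^+ m * w ^+ 'C(m.+1, 2) - q ^+ (m ^ 2) * pent_sum q m.
Proof.
elim: m => [|m IH]; first by rewrite hecke_sum0 pent_sum0 !mul1r subrr.
by rewrite hecke_sumS IH pent_sumS exprS; ring.
Qed.

Lemma hecke_sum_rec m : hecke_sum q m.+1 =
  q ^+ m.*2.+1 * hecke_sum q m
  + (1 - q ^+ m.*2.+1) * (-1) ^+ m * w ^+ 'C(m.+1, 2).
Proof.
have E := hecke_sum_closed m.
rewrite hecke_sumS (_ : q ^+ (m.+1 ^ 2) = q ^+ m.*2.+1 * q ^+ (m ^ 2)); last first.
  by rewrite -exprD; congr (q ^+ _); nia.
rewrite E; move: (q ^+ m.*2.+1) (q ^+ (m ^ 2)) (w ^+ _) => Q u c; ring.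
Qed.

(** The recurrence of hecke_sum_rec, normalized so that it has no negative powers
    of q. It is that of 1 - q^m times the coloured Jones polynomial of the
    trefoil. *)
Lemma hecke_sum_uniq (K : nat -> A) : K 0%N = 0 ->
  (forall m, K m.+1 = q ^+ m * (1 - q ^+ m.*2.+1) - q ^+ (3 * m).+2 * K m) ->
  forall m, hecke_sum q m = (-1) ^+ m.+1 * q * w ^+ 'C(m.+1, 2) * K m.
Proof.
move=> K0 KS; elim=> [|m IH]; first by rewrite hecke_sum0 K0 mulr0.
rewrite hecke_sum_rec IH KS ['C(m.+2, 2)]binS bin1 [w ^+ (_ + _)]exprD.
set c := w ^+ 'C(_, _).
have qw : w ^+ m.+1 * (q * q ^+ m) = 1 by rewrite -exprS -exprMn mulVr ?expr1n.
rewrite (_ : q ^+ (3 * m).+2 = q ^+ m.*2.+1 * (q * q ^+ m)); last first.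
  by rewrite -exprS -exprD; congr (q ^+ _); lia.
rewrite [(-1) ^+ m.+2]exprS [(-1) ^+ m.+1]exprS.
move: (q ^+ m.*2.+1) (w ^+ m.+1) (q ^+ m) ((-1) ^+ m) (K m) qw => Q v p e s qw.
transitivity ((v * (q * p)) * (e * (1 - Q) * c - e * q * c * Q * s)).
  by rewrite qw; ring.
by ring.
Qed.

(** When q^n = 1 the sum becomes the Kontsevich-Zagier sum at 1/q. *)
Lemma hecke_sum_kz n : hecke_sum q n = (1 - q ^+ n) *
  ((-1) ^+ n.+1 * w ^+ 'C(n, 2) *
   \sum_(0 <= k < n) (q ^+ n) ^+ k * qprod (q ^+ n) w k).
Proof.
pose S n := \sum_(0 <= k < n) (q ^+ n) ^+ k * qprod (q ^+ n) w k.
have qw : w * q = 1 by rewrite mulVr.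
have qwn j : w ^+ j * q ^+ j = 1 by rewrite -exprMn qw expr1n.
pose K n := w * q ^+ n * ((1 - q ^+ n) * S n).
rewrite (@hecke_sum_uniq K).
- rewrite /K -/(S n) ['C(n.+1, 2)]binS bin1 exprD.
  transitivity ((w * q) * (w ^+ n * q ^+ n) *
    ((1 - q ^+ n) * ((-1) ^+ n.+1 * w ^+ 'C(n, 2) * S n))); first by ring.
  by rewrite qw qwn; ring.
- by rewrite /K subrr mul0r mulr0.
move=> m; have := kz_telescope (q ^+ m.+1) w m.
have -> : q ^+ m.+1 * w = q ^+ m by rewrite exprSr -mulrA mulrV ?mulr1.
have q0 : qprod (q ^+ m.+1) w m.+1 = 0.
  by rewrite qprodS [q ^+ m.+1 * _]mulrC qwn subrr mulr0.
rewrite q0 -/(S m.+1) mulr0 subr0 => /(canRL (addrK _)) E.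
rewrite /K E (_ : \sum_(0 <= k < m) _ = (1 - q ^+ m) * S m); last first.
  rewrite /S mulr_sumr; apply: eq_bigr => k _.
  by rewrite qprodSl exprSr -[q ^+ m * q * w]mulrA [q * w]mulrC qw mulr1; ring.
rewrite (_ : q ^+ m.*2.+1 = q * q ^+ m * q ^+ m); last first.
  by rewrite -exprS -exprD; congr (q ^+ _); lia.
rewrite (_ : q ^+ (3 * m).+2 = (q * q ^+ m) * (q * q ^+ m) * q ^+ m); last first.
  by rewrite -exprS -!exprD; congr (q ^+ _); lia.
rewrite [q ^+ m.+1]exprS; move: (S m) (q ^+ m) => T p.
transitivity ((w * q) * p * (1 - (w * q) * q * p ^+ 2 -
    (w * q) ^+ 2 * q * p ^+ 3 * ((1 - p) * T))).
  by ring.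
transitivity (p * (1 - q * p * p) - (w * q) * (q * p ^+ 4 * ((1 - p) * T)));
  last by ring.
by rewrite qw; ring.
Qed.

(** When q^n = 1 the sum becomes that of (q)_k^2 q^k. *)
Lemma hecke_sum_unimodal n : hecke_sum q n = (1 - q ^+ n) *
  ((-1) ^+ n.+1 * q * w ^+ 'C(n.+1, 2) *
   \sum_(0 <= k < n) q ^+ k * qprod (w ^+ n) q k * qprod (q ^+ n) q k).
Proof.
pose S n := \sum_(0 <= k < n) q ^+ k * qprod (w ^+ n) q k * qprod (q ^+ n) q k.
have qw : w * q = 1 by rewrite mulVr.
have qwn j : w ^+ j * q ^+ j = 1 by rewrite -exprMn qw expr1n.
rewrite (@hecke_sum_uniq (fun n => (1 - q ^+ n) * S n)).
- by rewrite -/(S n); ring.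
- by rewrite subrr mul0r.
move=> m; have := @unimodal_telescope A q (q ^+ m) (w ^+ m.+1) m.+1.
rewrite -exprSr mulrC qwn => /(_ erefl).
have q0 : qprod (w ^+ m.+1) q m.+1 = 0 by rewrite qprodS qwn subrr mulr0.
(* The term k = m of the second sum contains a zero factor, so that both sums
   get the range of their own index. *)
rewrite q0 mul0r subr0 mulr1 [X in _ - _ * X]big_nat_recr //= q0 mulr0 mul0r addr0.
move=> /(canRL (subrK _)) E.
rewrite /S mulr_sumr (_ : \sum_(0 <= k < m.+1) _ =
  \sum_(0 <= k < m.+1) q ^+ k * qprod (w ^+ m.+1) q k * qprod (q ^+ m) q k.+1).
  rewrite E.
  rewrite -/(S m) (_ : \sum_(0 <= k < m) _ = (1 - w ^+ m) * S m).
    rewrite (_ : q ^+ m.*2.+1 = q * q ^+ m * q ^+ m); last first.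
      by rewrite -exprS -exprD; congr (q ^+ _); lia.
    rewrite (_ : q ^+ (3 * m).+2 = (q * q ^+ m) * (q * q ^+ m) * q ^+ m); last first.
      by rewrite -exprS -!exprD; congr (q ^+ _); lia.
    move: (qwn m); move: (S m) (q ^+ m) (w ^+ m) => T p v vp.
    transitivity (p * (1 - q * p ^+ 2) + q ^+ 2 * p ^+ 3 * (p - v * p) * T).
      by ring.
    by rewrite vp; ring.
  rewrite /S mulr_sumr; apply: eq_bigr => k _.
  by rewrite qprodSl exprSr -[w ^+ m * w * q]mulrA qw mulr1; ring.
apply: eq_bigr => k _; rewrite [qprod (q ^+ m) q _]qprodSl -exprSr; ring.
Qed.
End Hecke.

(** * Dual numbers *)

(** The pair (a, b) stands for a + b eps with eps^2 = 0; a type of its own keeps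
    its product apart from the componentwise one on pairs. *)
Definition dual (F : fieldType) : Type := (F * F)%type.

Section Dual.
Context {F : fieldType}.
Local Notation D := (dual F).
HB.instance Definition _ := GRing.Zmodule.copy D (F * F)%type.

Definition dual_re (x : D) : F := x.1.
Definition dual_im (x : D) : F := x.2.
Definition dual_one : D := (1, 0).
Definition dual_mul (x y : D) : D := (x.1 * y.1, x.1 * y.2 + x.2 * y.1).
Definition dual_unit : pred D := fun x => x.1 != 0.
Definition dual_inv (x : D) : D :=
  if dual_unit x then (x.1^-1, - x.2 / x.1 ^+ 2) else x.

Lemma dual_mulA : associative dual_mul.
Proof. by move=> [a b] [c d] [e f]; congr pair => /=; ring. Qed.
Lemma dual_mulC : commutative dual_mul.
Proof. by move=> [a b] [c d]; congr pair => /=; ring. Qed.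
Lemma dual_mul1 : left_id dual_one dual_mul.
Proof. by move=> [a b]; congr pair => /=; ring. Qed.
Lemma dual_mulDl : left_distributive dual_mul +%R.
Proof. by move=> [a b] [c d] [e f]; congr pair => /=; ring. Qed.
Lemma dual_one_neq0 : dual_one != 0.
Proof. by apply/eqP => -[/eqP]; rewrite oner_eq0. Qed.

HB.instance Definition _ := GRing.Zmodule_isComNzRing.Build D
  dual_mulA dual_mulC dual_mul1 dual_mulDl dual_one_neq0.

Lemma dual_mulVx : {in dual_unit, left_inverse 1 dual_inv *%R}.
Proof.
move=> [a b]; rewrite /dual_inv => ab; rewrite ifT //.
by have a0 : a != 0 := ab; congr pair => /=; field.
Qed.
Lemma dual_unitPl (x y : D) : y * x = 1 -> x \in dual_unit.
Proof.
move=> [yx _]; apply/negP => /eqP x0; move: yx; rewrite x0 mulr0 => /esym/eqP.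
by rewrite oner_eq0.
Qed.
Lemma dual_inv_out : {in [predC dual_unit], dual_inv =1 id}.
Proof. by move=> x /negPf nx; rewrite /dual_inv ifF. Qed.

HB.instance Definition _ := GRing.ComNzRing_hasMulInverse.Build D
  dual_mulVx dual_unitPl dual_inv_out.

Lemma dual_re_is_zmod : zmod_morphism dual_re. Proof. by []. Qed.
Lemma dual_re_is_monoid : monoid_morphism dual_re. Proof. by []. Qed.
Lemma dual_im_is_zmod : zmod_morphism dual_im. Proof. by []. Qed.
HB.instance Definition _ := GRing.isZmodMorphism.Build D F dual_re dual_re_is_zmod.
HB.instance Definition _ := GRing.isMonoidMorphism.Build D F dual_re dual_re_is_monoid.
HB.instance Definition _ := GRing.isZmodMorphism.Build D F dual_im dual_im_is_zmod.

Lemma dual_imM (x y : D) :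
  dual_im (x * y) = dual_re x * dual_im y + dual_im x * dual_re y.
Proof. by []. Qed.

Lemma dual_mulE (a b c d : F) : ((a, b) : D) * ((c, d) : D) = (a * c, a * d + b * c).
Proof. by []. Qed.

Context {z : F} (z0 : z != 0).

(** The point at which the eps-part of a Laurent polynomial f is z f'(z), rather
    than f'(z). *)
Definition tangent : D := (z, z).

Lemma tangent_unit : tangent \is a GRing.unit. Proof. exact: z0. Qed.

Lemma tangentX n : tangent ^+ n = (z ^+ n, n%:R * z ^+ n).
Proof.
elim: n => [|n IH]; first by rewrite !expr0 mul0r.
by rewrite exprS IH dual_mulE -natr1 exprS; congr pair; ring.
Qed.

Lemma tangentXz (e : int) : tangent ^ e = (z ^ e, e%:~R * z ^ e).
Proof.
case: e => n; first exact: tangentX.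
rewrite NegzE -[LHS]invr_expz; apply: mulr1_eq.
have zn : z ^+ n.+1 != 0 by rewrite expf_neq0.
rewrite -[tangent ^ _]/(tangent ^+ n.+1) tangentX -exprnN dual_mulE.
by congr pair => /=; [rewrite divff | rewrite mulrNz -pmulrn; field].
Qed.

Lemma dual_signz (j : int) : ((-1 : D) ^ j) = ((-1) ^ j, 0).
Proof.
have N1 : (-1 : D) = (-1, 0) by congr pair; rewrite oppr0.
have sg m : (-1 : D) ^+ m = ((-1) ^+ m, 0).
  by elim: m => // m IH; rewrite !exprS IH N1 dual_mulE; congr pair; ring.
case: j => n; first exact: sg.
by rewrite NegzE -!exprnN !invr_sign sg.
Qed.

(** The Euler operator q d/dq applied to hecke_sum q n. *)
Definition euler_hecke_sum (q : F) (n : nat) : F :=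
  int_sum (- n%:Z) (n%:Z - 1) (fun k : int => int_sum (- k) k (fun j : int =>
    (k ^+ 2 - pentagonal j)%:~R * q ^ (k ^+ 2 - pentagonal j) * (-1) ^ j)).

Lemma dual_im_hecke_sum n : dual_im (hecke_sum tangent n) = euler_hecke_sum z n.
Proof.
rewrite [LHS]int_sum_raddf; apply: eq_int_sum => k /=.
rewrite int_sum_raddf; apply: eq_int_sum => j /=.
by rewrite tangentXz dual_signz /= mulr0 add0r.
Qed.

Lemma dual_re_qprod (a q : D) k :
  dual_re (qprod a q k) = qprod (dual_re a) (dual_re q) k.
Proof.
by rewrite rmorph_prod; apply: eq_bigr => i _; rewrite rmorphB rmorphM rmorphXn rmorph1.
Qed.
End Dual.
Arguments tangent {F} z.

(** * Evaluation at a root of unity *)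

(** The product of all n-th roots of unity, read off from the constant term of
    'X^n - 1. *)
Lemma prim_root_bin2 {F : fieldType} {n} {z : F} : n.-primitive_root z ->
  z ^+ 'C(n, 2) = (-1) ^+ n.+1.
Proof.
move=> hz; have n0 := prim_order_gt0 hz.
have := congr1 (horner^~ 0) (factor_Xn_sub_1 hz).
rewrite horner_prod !hornerE expr0n gtn_eqF // mulr0n sub0r.
under eq_bigr => i _ do rewrite hornerXsubC sub0r.
rewrite big_mkord prodrN cardT size_enum_ord prodrXr -(big_mkord predT id).
rewrite bin2_sum => h.
by rewrite -[LHS](signrMK n) h exprSr.
Qed.

Lemma prim_rootV {F : fieldType} {n} {z : F} :
  n.-primitive_root z -> n.-primitive_root z^-1.
Proof.
case/andP=> n0 /forallP hz; apply/andP; split=> //; apply/forallP => i.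
by rewrite -(eqP (hz i)) !unity_rootE exprVn invr_eq1.
Qed.

Section RootOfUnity.
Context {F : fieldType} {n : nat} {z : F} (hz : n.-primitive_root z).

Let z0 : z != 0.
Proof.
have := oner_neq0 F; rewrite -(prim_expr_order hz) expf_eq0.
by rewrite (prim_order_gt0 hz).
Qed.

(** As 1 - (z + z eps)^n = - n eps, only the value of the cofactor at z is
    needed, not its derivative. *)
Lemma euler_hecke_sum_factor {c : dual F} :
  hecke_sum (tangent z) n = (1 - tangent z ^+ n) * c ->
  euler_hecke_sum z n = - n%:R * dual_re c.
Proof.
move=> E; rewrite -dual_im_hecke_sum // E dual_imM tangentX (prim_expr_order hz).
by rewrite /dual_re /dual_im /= subrr mul0r add0r sub0r mulr1.
Qed.

Let kz_prefactor : (-1) ^+ n.+1 * z^-1 ^+ 'C(n, 2) = 1.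
Proof. by rewrite exprVn (prim_root_bin2 hz) divrr // unitrX // unitrN1. Qed.

Let unimodal_prefactor : (-1) ^+ n.+1 * z^-1 ^+ 'C(n.+1, 2) = 1.
Proof.
rewrite binS bin1 [z^-1 ^+ _]exprD [z^-1 ^+ n]exprVn (prim_expr_order hz).
by rewrite invr1 mulr1 kz_prefactor.
Qed.

Lemma euler_hecke_sum_kz :
  euler_hecke_sum z n = - n%:R * \sum_(0 <= k < n) qpoch z^-1 k.
Proof.
rewrite (euler_hecke_sum_factor (hecke_sum_kz (tangent_unit z0) n)); congr (_ * _).
rewrite !rmorphM rmorphXn rmorphN1 rmorphXn rmorphV ?(tangent_unit z0) //=.
rewrite kz_prefactor mul1r.
rewrite rmorph_sum; apply: eq_bigr => k _.
rewrite rmorphM !rmorphXn /= dual_re_qprod rmorphXn rmorphV ?(tangent_unit z0) //=.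
by rewrite (prim_expr_order hz) expr1n mul1r qprod1.
Qed.

Lemma euler_hecke_sum_unimodal :
  euler_hecke_sum z n = - n%:R * \sum_(0 <= k < n) qpoch z k ^+ 2 * z ^+ k.+1.
Proof.
rewrite (euler_hecke_sum_factor (hecke_sum_unimodal (tangent_unit z0) n)); congr (_ * _).
rewrite !rmorphM rmorphXn rmorphN1 rmorphXn rmorphV ?(tangent_unit z0) //=.
rewrite [_ * z * _]mulrAC unimodal_prefactor mul1r.
rewrite rmorph_sum mulr_sumr; apply: eq_bigr => k _.
rewrite !rmorphM !rmorphXn /= !dual_re_qprod !rmorphXn rmorphV ?(tangent_unit z0) //=.
rewrite exprVn (prim_expr_order hz) invr1 !qprod1 [z ^+ k.+1]exprS; ring.
Qed.
End RootOfUnity.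

Theorem proposition3p1 (R : realType) (n : nat) (q : R[i]) (hn : (1 <= n)%N)
    (hq : n.-primitive_root q) :
  \sum_(0 <= k < n) qpoch q k =
    (-1) / n%:R *
      int_sum (- n%:Z) (n%:Z - 1) (fun k : int =>
        int_sum (- k) k (fun j : int =>
          (k ^+ 2 - pentagonal j)%:~R * q ^ (- k ^+ 2 + pentagonal j)
            * (-1) ^ j))
  /\
  \sum_(0 <= k < n) qpoch q k ^+ 2 * q ^+ k.+1 =
    (-1) / n%:R *
      int_sum (- n%:Z) (n%:Z - 1) (fun k : int =>
        int_sum (- k) k (fun j : int =>
          (k ^+ 2 - pentagonal j)%:~R * q ^ (k ^+ 2 - pentagonal j)
            * (-1) ^ j)).
Proof.
have n0 : n%:R != 0 :> R[i] by rewrite pnatr_eq0 -lt0n.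
have cancel_n (x : R[i]) : x = -1 / n%:R * (- n%:R * x) by field.
split; last by rewrite -/(euler_hecke_sum q n) (euler_hecke_sum_unimodal hq) -cancel_n.
(* q^-1 replaces q, as the exponents of the first identity are the opposites of
   those of the second. *)
have hq' := prim_rootV hq.
rewrite [LHS]cancel_n -[q in LHS]invrK -(euler_hecke_sum_kz hq'); congr (_ * _).
apply: eq_int_sum => k; apply: eq_int_sum => j.
by rewrite -expfV invr_expz opprB [- _ + _]addrC.
Qed.
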